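(* The log-concavity deviation of the rows $\mathcal T_{n,*}=[\mathcal T_{n,1},\dots,\mathcal T_{n,n+1}]$ satisfies $$\Theta(\mathcal T_{n,*})\to\log(4/3)\quad\text{as } n\to\infty.$$
   Context: Define $\psi:\{1,2,3,\dots\}\to\{0,1,2,\dots\}$ by $\psi(1)=0$, $\psi(2)=1$, $\psi(3)=2$ and $\psi(j)=\sum_{k=1}^{j-1}\psi(k)$ for $j\ge 4$. The triangular array $\mathcal T=(\mathcal T_{n,j})$, $n\ge 0$, $1\le j\le n+1$, of integers is defined recursively by: $\mathcal T_{n,n+1}=1$ for every $n\ge 0$; $\mathcal T_{1,1}=1$, $\mathcal T_{2,2}=2$, $\mathcal T_{3,3}=3$; $\mathcal T_{n,n}=\sum_{k=1}^{n-2}\mathcal T_{n-k,n-k}$ for every $n\ge 4$; and $\mathcal T_{n,j}=\mathcal T_{n-1,j}+\psi(j)$ for every $n\ge 2$ and $1\le j\le n-1$. For a sequence $\eta=[\eta_1,\dots,\eta_{n+1}]$, $n\ge2$, of strictly positive reals, its log-concavity deviation (under logarithmic scaling) is $\Theta(\eta)=\sum_{i=2}^{n}\Theta_i(\eta)$, where $\Theta_i(\eta)=\max\left(\log\eta_{i-1}+\log\eta_{i+1}-2\log\eta_i,\,0\right)$; $\log$ is the natural logarithm. *)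

(* Defs.v *)
From HB Require Import structures.
From mathcomp Require Import all_boot all_order all_algebra.
From mathcomp Require Import all_classical all_reals all_analysis.
Set Implicit Arguments.
Unset Strict Implicit.
Unset Printing Implicit Defensive.
Import Order.TTheory GRing.Theory Num.Theory.
Import numFieldNormedType.Exports.

Local Open Scope nat_scope.

(* Course-of-values recursion: [psi_vals n] is [psi 1; ...; psi n]. *)
Fixpoint psi_vals (n : nat) : seq nat :=
  if n is m.+1 then
    let s := psi_vals m in
    rcons s (match m.+1 with 1 => 0 | 2 => 1 | 3 => 2 | _ => sumn s end)
  else [::].

Definition psi (j : nat) : nat := last 0 (psi_vals j).

(* [diag_vals n] is [T_{1,1}; ...; T_{n,n}], T being [calT] below; the recursive
   sum is T_{2,2} + ... + T_{n-1,n-1}, without T_{1,1}. *)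
Fixpoint diag_vals (n : nat) : seq nat :=
  if n is m.+1 then
    let s := diag_vals m in
    rcons s (match m.+1 with 1 => 1 | 2 => 2 | 3 => 3 | _ => sumn (behead s) end)
  else [::].

(* Only the entries with 1 <= j <= n + 1 are meaningful. *)
Fixpoint calT (n j : nat) : nat :=
  if j == n.+1 then 1
  else if j == n then last 0 (diag_vals n)
  else if n is m.+1 then calT m j + psi j else 0.

Lemma psi1 : psi 1 = 0. Proof. by []. Qed.
Lemma psi2 : psi 2 = 1. Proof. by []. Qed.
Lemma psi3 : psi 3 = 2. Proof. by []. Qed.

Lemma psi_valsE n : psi_vals n = [seq psi k | k <- iota 1 n].
Proof.
elim: n => // n IHn.
by rewrite -addn1 iotaD map_cat -IHn addn1 cats1 /= /psi last_rcons.
Qed.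

Lemma psi_rec j : 4 <= j -> psi j = \sum_(1 <= k < j) psi k.
Proof.
case: j => [|[|[|[|j]]]] // _.
have -> : psi j.+4 = sumn (psi_vals j.+3) by rewrite /psi last_rcons.
by rewrite psi_valsE sumnE big_map /index_iota subn1.
Qed.

Lemma calT_last n : calT n n.+1 = 1.
Proof. by case: n => // n; rewrite /calT eqxx. Qed.

Lemma calT11 : calT 1 1 = 1. Proof. by []. Qed.
Lemma calT22 : calT 2 2 = 2. Proof. by []. Qed.
Lemma calT33 : calT 3 3 = 3. Proof. by []. Qed.

Lemma calT_diagE n : calT n n = last 0 (diag_vals n).
Proof. by case: n => // n; rewrite /calT eqxx ltn_eqF. Qed.

Lemma diag_valsE n : diag_vals n = [seq calT k k | k <- iota 1 n].
Proof.
elim: n => // n IHn.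
rewrite -addn1 iotaD map_cat -IHn addn1 cats1 -[RHS]/(rcons _ (calT n.+1 n.+1)).
by rewrite calT_diagE /= last_rcons.
Qed.

Lemma calT_diag_rec n : 4 <= n -> calT n n = \sum_(1 <= k < n.-1) calT (n - k) (n - k).
Proof.
case: n => [|[|[|[|n]]]] // _.
have -> : calT n.+4 n.+4 = sumn (behead (diag_vals n.+3)).
  by rewrite calT_diagE last_rcons.
rewrite diag_valsE sumnE -[behead _]/[seq calT k k | k <- index_iota 2 n.+4].
rewrite big_map big_nat_rev.
by rewrite big_add1 /= !add2n.
Qed.

Lemma calT_rec n j : 2 <= n -> 1 <= j <= n.-1 -> calT n j = calT n.-1 j + psi j.
Proof.
case: n => // n _ /andP[_ /= lejn].
by rewrite !ltn_eqF // ltnS // leqW.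
Qed.

Lemma calT_gt0 n j : 1 <= j <= n.+1 -> 0 < calT n j.
Proof.
have diag_gt0 m : 0 < calT m.+1 m.+1.
  have [m' le_m'm] := ubnP m; elim: m' m le_m'm => // m' IHm [|[|[|m]]] // ltm.
  by rewrite calT_diag_rec // big_ltn // subSS subn0 addn_gt0 IHm.
elim: n => [|n IHn] /andP[j_gt0]; first by case: j j_gt0 => [|[]].
rewrite leq_eqVlt ltnS => /predU1P[->|]; first by rewrite calT_last.
rewrite leq_eqVlt ltnS => /predU1P[->|le_jn]; first exact: diag_gt0.
rewrite calT_rec ?j_gt0 //; last by rewrite ltnS (leq_trans j_gt0).
by rewrite addn_gt0 IHn // j_gt0 leqW.
Qed.

Local Open Scope ring_scope.

Section Deviation.
Context {R : realType}.

(* [eta] lists eta_1, ..., eta_{n+1}: eta_i is entry i - 1 of the list, and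
   the terms with i = 2, ..., n are those with 2 <= i < size eta. *)
Definition Theta_i (eta : seq R) (i : nat) : R :=
  Num.max (ln eta`_i.-2 + ln eta`_i - 2 * ln eta`_i.-1) 0.

Definition Theta (eta : seq R) : R := \sum_(2 <= i < size eta) Theta_i eta i.

End Deviation.

Definition calT_row (R : realType) (n : nat) : seq R :=
  [seq (calT n j)%:R | j <- iota 1 n.+1].

(* Main.v *)
Require Import Defs.
From mathcomp Require Import all_boot all_order all_algebra.
From mathcomp Require Import all_classical all_reals all_analysis.
From mathcomp Require Import zify ring lra.
Import Order.TTheory GRing.Theory Num.Theory.
Import numFieldNormedType.Exports.
Local Open Scope classical_set_scope.
Local Open Scope ring_scope.

(** Each defining recursion is a sum of earlier values of psi or of the
    diagonal: passing to the next index adds the last value, so psi and the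
    diagonal both double at each step from index 4 on: psi (j + 4) is 3 * 2 ^ j
    and T_{j+4,j+4} is 5 * 2 ^ j. As T_{n,j} is affine in n with slope psi j,
    the row n >= 4 is
      1, n, 2 n - 3, then 2 ^ (j - 4) * (3 (n - j) + 5) for 4 <= j <= n, then 1
    ([calT_column1], [calT_column2], [calT_column3], [calT_column_ge4]).
    Such a row is log-concave except at position 4 ([calT_log_concave]). From
    position 5 on, away from the last entry, the powers of 2 cancel and what
    remains is an arithmetic progression, which is log-concave; the initial
    terms are compared directly, and the end of the row is a plain drop.
    At position 4 the three entries involved grow in n with slopes psi 3 = 2,
    psi 4 = 3 and psi 5 = 6, where a geometric sequence would need 3 / 2 in
    place of 2: the ratio T_{n,3} T_{n,5} / T_{n,4} ^ 2 tends to
    2 * 6 / 3 ^ 2 = 4 / 3.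
    The deviation is thus the logarithm of this single ratio
    ([Theta_calT_rowE]), and the limit follows by continuity. *)

Lemma psi_geometric j : psi j.+4 = (3 * 2 ^ j)%N.
Proof.
elim: j => // j IHj.
by rewrite psi_rec // big_nat_recr //= -psi_rec // IHj expnS; lia.
Qed.

Lemma calT_diag_geometric j : calT j.+4 j.+4 = (5 * 2 ^ j)%N.
Proof.
elim: j => // j IHj.
rewrite calT_diag_rec // big_ltn // subn1 big_add1.
under eq_bigr do rewrite subSS.
by rewrite -(@calT_diag_rec j.+4 isT) IHj expnS; lia.
Qed.

Lemma calT_column n j : (0 < j <= n)%N ->
  calT n j = (calT j j + (n - j) * psi j)%N.
Proof.
move=> /andP[j_gt0 /subnK <-]; elim: (n - j)%N => [|d IHd].
  by rewrite subnn addn0.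
rewrite addSn calT_rec /=; [|lia|lia].
by rewrite IHd; lia.
Qed.

Lemma calT_column1 n : (0 < n)%N -> calT n 1 = 1%N.
Proof. by move=> n_gt0; rewrite calT_column // calT11 psi1 muln0. Qed.

Lemma calT_column2 n : (1 < n)%N -> calT n 2 = n.
Proof. by move=> n_gt1; rewrite calT_column // calT22 psi2; lia. Qed.

Lemma calT_column3 n : (2 < n)%N -> calT n 3 = (2 * n - 3)%N.
Proof. by move=> n_gt2; rewrite calT_column // calT33 psi3; lia. Qed.

Lemma calT_column_ge4 n j : (j.+4 <= n)%N ->
  calT n j.+4 = (2 ^ j * (3 * (n - j.+4) + 5))%N.
Proof.
move=> le_jn.
by rewrite calT_column // calT_diag_geometric psi_geometric; lia.
Qed.

(** The exception is genuine: at position 4 the inequality is reversed for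
    every n > 4, since psi 3 = 2 exceeds the value 3 / 2 that would make psi
    geometric from index 3 on. *)
Lemma calT_log_concave n i : (4 < n)%N -> (1 < i <= n)%N -> i != 4 ->
  (calT n i.-1 * calT n i.+1 <= calT n i ^ 2)%N.
Proof.
move=> n_gt4 /andP[i_gt1].
rewrite leq_eqVlt => /predU1P[->|lt_in] i_neq4.
  (* The right neighbour of the last diagonal entry is 1. *)
  case: n {i_gt1 i_neq4} n_gt4 => [|[|[|[|[|m]]]]] // _.
  rewrite calT_last !calT_column_ge4 // -mulnn expnS /=.
  by have := expn_gt0 2 m; nia.
case: i i_gt1 lt_in i_neq4 => [|[|[|[|[|j]]]]] //= _ lt_in _.
- rewrite calT_column1 ?calT_column2 ?calT_column3; [|lia..].
  by rewrite -mulnn; nia.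
- rewrite calT_column2 ?calT_column3 ?calT_column_ge4; [|lia..].
  by rewrite -mulnn; nia.
rewrite !calT_column_ge4 //; [|lia..].
(* With d = n - i - 1, the factors besides the powers of 2 are the arithmetic
   progression 3 d + 11, 3 d + 8, 3 d + 5. *)
have -> : (n - j.+4 = n - j.+4.+2 + 2)%N by lia.
have -> : (n - j.+4.+1 = n - j.+4.+2 + 1)%N by lia.
move: (n - _)%N => d.
have -> : (2 ^ j * (3 * (d + 2) + 5) * (2 ^ j.+2 * (3 * d + 5)) =
  (2 ^ j.+1) ^ 2 * ((3 * (d + 2) + 5) * (3 * d + 5)))%N.
  by rewrite !expnS expn0; ring.
by rewrite expnMn leq_mul2l; apply/orP; right; rewrite -mulnn; nia.
Qed.

Lemma nth_calT_row (R : realType) n k : (k <= n)%N ->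
  (calT_row R n)`_k = (calT n k.+1)%:R.
Proof. by move=> le_kn; rewrite (nth_map 0) ?size_iota // nth_iota. Qed.

Lemma Theta_i_calT_row_ln (R : realType) n i : (1 < i <= n)%N ->
  Theta_i (calT_row R n) i =
  Num.max (ln ((calT n i.-1)%:R * (calT n i.+1)%:R / (calT n i)%:R ^+ 2)) 0.
Proof.
case: i => [|[|i]] //= lt_in.
have T_pos j : (0 < j <= n.+1)%N -> (calT n j)%:R \is @Num.pos R.
  by move=> le_jn; rewrite posrE ltr0n calT_gt0.
rewrite /Theta_i !nth_calT_row /=; [|lia..].
rewrite expr2 ln_div ?lnM ?posrE ?mulr_gt0 -?posrE ?T_pos //; [|lia..].
by congr Num.max; ring.
Qed.

Lemma Theta_i_calT_row_eq0 (R : realType) n i : (4 < n)%N -> (1 < i <= n)%N ->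
  i != 4 -> Theta_i (calT_row R n) i = 0.
Proof.
move=> n_gt4 lt_in i_neq4; rewrite Theta_i_calT_row_ln //; apply/max_idPr.
have T_gt0 : (0 < calT n i)%N by apply: calT_gt0; lia.
apply: ln_le0; rewrite ler_pdivrMr ?exprn_gt0 ?ltr0n // mul1r.
by rewrite -natrM -natrX ler_nat calT_log_concave.
Qed.

(** The maximum with 0 disappears because the ratio at position 4 is at least 1
    for n > 4: this amounts to 3 n ^ 2 - 16 n + 11 >= 0. Dividing through by
    n ^ 2 makes the ratio a continuous function of 1 / n. *)
Lemma Theta_calT_rowE (R : realType) n : (4 < n)%N ->
  Theta (calT_row R n) =
  ln ((2 - 3 / n%:R) * (6 - 20 / n%:R) / (3 - 7 / n%:R) ^+ 2).
Proof.
move=> n_gt4; rewrite /Theta /calT_row size_map size_iota -/(calT_row R n).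
do 3 (rewrite big_ltn; last lia).
rewrite [X in _ + (_ + (_ + X))]big_nat big1 ?addr0; last first.
  by move=> i lt_in; rewrite Theta_i_calT_row_eq0 //; lia.
rewrite !(@Theta_i_calT_row_eq0 _ _ 2, @Theta_i_calT_row_eq0 _ _ 3) //; [|lia..].
rewrite !add0r Theta_i_calT_row_ln //=; last lia.
rewrite calT_column3 ?calT_column_ge4 //; [|lia..].
have n_ge5 : (5 : R) <= n%:R by rewrite ler_nat.
have -> : (2 * n - 3)%N%:R = 2 * n%:R - 3 :> R.
  by rewrite natrB ?natrM //; lia.
have -> : (2 ^ 1 * (3 * (n - 5) + 5))%N%:R = 6 * n%:R - 20 :> R.
  rewrite -[RHS]/(6%:R * n%:R - 20%:R) -natrM -natrB; last lia.
  by congr (_%:R); lia.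
have -> : (2 ^ 0 * (3 * (n - 4) + 5))%N%:R = 3 * n%:R - 7 :> R.
  rewrite -[RHS]/(3%:R * n%:R - 7%:R) -natrM -natrB; last lia.
  by congr (_%:R); lia.
move: (n%:R : R) n_ge5 => x x_ge5.
rewrite max_l.
  congr ln; field; apply/andP; split; apply/eqP => ?; lra.
apply: ln_ge0; rewrite ler_pdivlMr ?exprn_gt0 //; last lra.
rewrite mul1r; nra.
Qed.

Theorem proposition2p9 (R : realType) :
  Theta (calT_row R n) @[n --> \oo] --> (ln (4 / 3) : R).
Proof.
have invn_cvg0 : (n%:R^-1 : R) @[n --> \oo] --> (0 : R).
  apply/gtr0_cvgV0; last exact: cvgr_idn.
  by near=> n; rewrite ltr0n; near: n; exact: nbhs_infty_gt.
have affine_cvg (a b : R) : (a - b / n%:R) @[n --> \oo] --> a.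
  rewrite -[X in _ --> X]subr0 -[X in _ --> _ - X](mulr0 b).
  by apply: cvgB; [exact: cvg_cst | exact: cvgMr].
apply: cvg_trans (_ :
  ln ((2 - 3 / n%:R) * (6 - 20 / n%:R) / (3 - 7 / n%:R) ^+ 2) @[n --> \oo]
    --> (ln (4 / 3) : R)).
  apply: near_eq_cvg; near=> n; rewrite Theta_calT_rowE //.
  by near: n; exact: nbhs_infty_gt.
have -> : (4 / 3 : R) = 2 * 6 / 3 ^+ 2 by field.
apply: continuous_cvg; first by apply: continuous_ln; lra.
apply: cvgM; first exact: cvgM.
apply: cvgV; first by rewrite expf_neq0 // pnatr_eq0.
by rewrite expr2; exact: cvgM.
Unshelve. all: end_near.
Qed.
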